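(* Let $n\ge 1$ be an integer, let $\mathcal{S}_n$ be the set of singleton-free partitions of $[n]$ and let $\mathcal{A}_n$ be the set of adjacency-free partitions of $[n]$. Then there exists an (explicit) bijection $\Phi:\mathcal{S}_n\to\mathcal{A}_n$ with the following properties. (1) If $n$ is not an even integer greater than $2$, then $\Phi(P)\preceq P$ for every $P\in\mathcal{S}_n$. If $n>2$ is even, then there is exactly one $P\in\mathcal{S}_n$ for which $\Phi(P)\preceq P$ fails. (2) $\Phi$ restricts to a bijection between the noncrossing partitions in $\mathcal{S}_n$ and the noncrossing partitions in $\mathcal{A}_n$ (the same map $\Phi$, without modification). Moreover, if $n>2$ is even, an exception is unavoidable: for every bijection $\Psi:\mathcal{S}_n\to\mathcal{A}_n$ there is at least one $P\in\mathcal{S}_n$ such that $\Psi(P)\preceq P$ fails.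
   Context: $[n]=\{1,\dots,n\}$. A partition of $[n]$ is a set of nonempty, pairwise disjoint subsets of $[n]$ (called blocks) whose union is $[n]$. Elements of $[n]$ are read cyclically modulo $n$, so the cyclic successor of $n$ is $1$. A partition of $[n]$ is singleton-free if it has no block of size $1$. A partition of $[n]$ is adjacency-free if there is no $i\in[n]$ such that $i$ and its cyclic successor $i+1 \pmod n$ lie in the same block (for $n=1$ the element $1$ is its own cyclic successor, so no partition of $[1]$ is adjacency-free). The refinement order: for partitions $P_1,P_2$ of $[n]$, write $P_1\preceq P_2$ if every block of $P_1$ is contained in a block of $P_2$. A partition of $[n]$ is noncrossing if there are no $a<b<c<d$ in $[n]$ such that $a,c$ lie in one block and $b,d$ lie in a different block. *)

(* Defs.v *)
From mathcomp Require Import all_boot.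

Set Implicit Arguments.
Unset Strict Implicit.
Unset Printing Implicit Defensive.

(* The ground set [n] is rendered as 'I_n = {0, ..., n-1}, i.e. shifted down
   by one.  A partition of [n] is P : {set {set 'I_n}} such that
   [partition P setT]. *)

Definition singleton_free n (P : {set {set 'I_n}}) : bool :=
  [forall B in P, #|B| != 1].

(* [ordS i] is i + 1 modulo n; for n = 1 it is i itself. *)
Definition adjacency_free n (P : {set {set 'I_n}}) : bool :=
  [forall B in P, forall i : 'I_n, ~~ ((i \in B) && (ordS i \in B))].

Definition noncrossing n (P : {set {set 'I_n}}) : bool :=
  ~~ [exists B in P, exists C in P,
        (B != C) &&
        [exists a : 'I_n, exists b : 'I_n, exists c : 'I_n, exists d : 'I_n,
           [&& a < b, b < c, c < d,
               a \in B, c \in B, b \in C & d \in C]]].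

Definition refines n (P1 P2 : {set {set 'I_n}}) : bool :=
  [forall B in P1, exists C in P2, B \subset C].

Definition SF n : {set {set {set 'I_n}}} :=
  [set P | partition P [set: 'I_n] & singleton_free P].

Definition AF n : {set {set {set 'I_n}}} :=
  [set P | partition P [set: 'I_n] & adjacency_free P].

Definition NC n : {set {set {set 'I_n}}} :=
  [set P | partition P [set: 'I_n] & noncrossing P].

(* A map X -> Y is represented by a total function on the ambient type, whose
   values outside X are irrelevant. *)
Definition bij_between (T U : finType) (f : T -> U) (X : {set T}) (Y : {set U})
    : Prop :=
  {in X &, injective f} /\ f @: X = Y.

(* Main.v *)
Require Import Defs.
From mathcomp Require Import all_boot.
From mathcomp Require Import zify.

Set Implicit Arguments.
Unset Strict Implicit.
Unset Printing Implicit Defensive.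

(** Cut every block of a singleton-free partition [P] into its maximal runs of
    cyclically consecutive elements, mark the second, fourth, sixth, ... element
    of each run, and turn the marked elements into singletons.  No two adjacent
    elements stay together, so the result [Q] is adjacency-free, and it refines
    [P].  Conversely [Q] determines the marks: a two-element run that is a whole
    block has fallen apart into two singletons and every other block keeps its
    unmarked elements as a block of size at least two, so a maximal run of
    singletons of [Q] is alternately marked and unmarked, starting from its last
    element.  Attaching each marked element to the block of its predecessor
    gives [P] back.

    Both rules for the marks [E] are local recursions around the circle: for [P],
    [x + 1] is marked iff [x + 1] is in the block of [x] and [x] is not marked
    ([marks]); for [Q], [x] is marked iff [x] is a singleton and [x + 1] is not
    marked ([comarks]).  [isolate_marks] and [attach_comarks] say that the pairs
    [(P, E)] of the first kind and the pairs [(Q, E)] of the second kind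
    correspond to each other.

    Such a recursion has exactly one solution unless its condition holds all
    around the circle, that is, unless [P] is the one-block partition [top] or
    [Q] is the discrete partition [bot].  There [E] must alternate: this is
    impossible for odd [n], and [top] is then sent to [bot]; for even [n] both
    the odd and the even positions solve the recursion, so [top] and [bot] each
    carry two mark sets.  Choosing the odd positions for both leaves over the
    pairing obtained from [bot] with the even marks, on one side, and the image
    of [top] with the even marks, on the other side; matching these two
    partitions creates the single exception.  For [n = 2] the two leftovers are
    [top] and [bot] themselves, which causes no failure of refinement.

    Isolating and attaching both preserve noncrossing partitions, because an
    element is only made a singleton, or glued to its neighbour.  An exception is
    unavoidable because the only adjacency-free partition below either of the two
    pairings of neighbours is [bot]. *)

(** * Partitions as kernels *)

Section Kernels.
Variable T : finType.
Implicit Types (P Q : {set {set T}}) (E : {set T}).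

(** Every construction below is a kernel [ker f], so that equality of labels
    decides when two elements share a block. *)
Definition same P : rel T := fun x y => pblock P x == pblock P y.

Definition ker (rT : eqType) (f : T -> rT) := preim_partition f [set: T].

Lemma ker_partition (rT : eqType) (f : T -> rT) : partition (ker f) setT.
Proof. exact: preim_partitionP. Qed.

Lemma sameE P x y : partition P setT -> same P x y = (y \in pblock P x).
Proof.
move=> Ppart; have /and3P[_ Ptriv _] := Ppart.
by rewrite -eq_pblock // (cover_partition Ppart) inE.
Qed.

Lemma in_cover P x : partition P setT -> x \in cover P.
Proof. by move=> Pp; rewrite (cover_partition Pp) inE. Qed.

Lemma same_ker (rT : eqType) (f : T -> rT) x y : same (ker f) x y = (f x == f y).
Proof.
rewrite sameE ?ker_partition // pblock_equivalence_partition ?inE //.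
by split=> // /eqP->.
Qed.

Lemma same_sym P : symmetric (same P).
Proof. by move=> x y; rewrite /same eq_sym. Qed.

Lemma same_trans P : transitive (same P).
Proof. by move=> y x z /eqP e1 /eqP e2; rewrite /same e1 e2. Qed.

Lemma same_refl P : reflexive (same P).
Proof. by move=> x; rewrite /same. Qed.

Lemma same_ext P Q : partition P setT -> partition Q setT ->
  same P =2 same Q -> P = Q.
Proof.
move=> Pp Qp PQ.
rewrite -(preim_partition_pblock Pp) -(preim_partition_pblock Qp).
rewrite /preim_partition /equivalence_partition; apply: eq_imset => x.
by apply/setP=> y; rewrite !inE; apply: PQ.
Qed.

Definition single P x := [forall y, (y != x) ==> ~~ same P x y].

Lemma singleP P x : reflect (forall y, same P x y -> y = x) (single P x).
Proof.
apply: (iffP forallP) => [s y xy|s y].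
  by apply/eqP; apply: contraTT xy; apply/implyP.
by apply/implyP; apply: contraNN => /s ->.
Qed.

Lemma singleN P x : ~~ single P x -> exists2 y, y != x & same P x y.
Proof.
by case/forallPn=> y; rewrite negb_imply negbK => /andP[]; exists y.
Qed.

Definition top : {set {set T}} := ker (fun=> tt).
Definition bot : {set {set T}} := ker id.

Lemma same_top x y : same top x y.
Proof. by rewrite same_ker. Qed.

Lemma same_bot x y : same bot x y = (x == y).
Proof. by rewrite same_ker. Qed.

Lemma botP P : partition P setT -> (forall x, single P x) -> P = bot.
Proof.
move=> Pp s; apply: same_ext (ker_partition _) _ => // x y.
rewrite same_bot; apply/idP/eqP => [|->]; last exact: same_refl.
by move/(singleP _ _ (s x)).
Qed.

(** The two summands keep the labels of isolated elements apart from the labels of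
    the surviving blocks. *)
Definition isolate P E : {set {set T}} :=
  ker (fun x => if x \in E then inl x else inr (pblock P x)).

Lemma same_isolate P E x y :
  same (isolate P E) x y = (x == y) || [&& x \notin E, y \notin E & same P x y].
Proof.
rewrite same_ker; have [->|xy] := eqVneq x y; first by rewrite eqxx.
case: ifP => xE; case: ifP => yE //=.
by apply/eqP => -[] /eqP; rewrite (negPf xy).
Qed.

Lemma refinesP P Q : partition P setT -> partition Q setT ->
  reflect (forall x y, same P x y -> same Q x y)
    [forall B in P, exists C in Q, B \subset C].
Proof.
move=> Pp Qp; apply: (iffP forall_inP) => [r x y|r B BP].
  rewrite !sameE //.
  have xP := in_cover x Pp.
  have /exists_inP[C CQ /subsetP sub] := r _ (pblock_mem xP).
  have /and3P[_ Qt _] := Qp.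
  by move=> yx; rewrite (def_pblock Qt CQ (sub x _)) ?mem_pblock // sub.
have /and3P[_ Pt P0] := Pp.
have [B0|[x xB]] := set_0Vmem B; first by rewrite -B0 BP in P0.
apply/exists_inP; exists (pblock Q x); first exact/pblock_mem/in_cover.
apply/subsetP=> y yB; rewrite -sameE //; apply: r.
by rewrite sameE // (def_pblock Pt BP xB).
Qed.

End Kernels.
Arguments top {T}.
Arguments bot {T}.

(** * Alternating recursions around a circle *)

Section Recursion.
Variables (T : finType) (f g : T -> T).
Hypothesis fK : cancel f g.
Hypothesis f_cyclic : forall x y, exists k, iter k f x = y.
Implicit Types (a : pred T) (E : {set T}).

Definition alternates a E := forall x, (f x \in E) = a x && (x \notin E).

Lemma alternates_ext a E E' x : alternates a E -> alternates a E' ->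
  (x \in E) = (x \in E') -> E = E'.
Proof.
move=> aE aE' e; apply/setP=> y; have [k <-] := f_cyclic x y.
by elim: k => //= k IHk; rewrite aE aE' IHk.
Qed.

Lemma alternates_unique a E E' x : ~~ a x -> alternates a E -> alternates a E' ->
  E = E'.
Proof.
move=> /negPf ax aE aE'; apply: (alternates_ext (x := f x) aE aE').
by rewrite aE aE' ax.
Qed.

(** Walking backwards from a point, [a] eventually fails because the walk reaches
    [x]; the parity of the number of steps before the first failure obeys the
    recursion. *)
Lemma alternates_exists a x : ~~ a x -> exists E, alternates a E.
Proof.
move=> ax.
have run y : exists k, ~~ a (iter k g y).
  have [k <-] := f_cyclic x y; exists k.
  suff -> : iter k g (iter k f x) = x by [].
  by elim: k => //= k IHk; rewrite -iterS iterSr fK.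
exists [set y | odd (ex_minn (run (g y)))] => y; rewrite !inE fK.
case: ex_minnP => k ak mink; case: ex_minnP => l al minl.
case: (boolP (a y)) => ay /=; last by case: k mink {ak} => // k /(_ 0 ay).
have -> : k = l.+1; last by [].
apply/eqP; rewrite eqn_leq mink /=; last by rewrite -iterS iterSr.
case: k ak {mink} => [|k]; first by rewrite /= ay.
by rewrite iterSr => /minl.
Qed.

(** When [a] holds everywhere a solution need not be unique, or exist at all;
    [E0] prescribes the choice in that case. *)
Definition solution a (E0 : {set T}) :=
  odflt E0 [pick E : {set T} | ~~ [forall x, a x]
                             & [forall x, (f x \in E) == a x && (x \notin E)]].

Lemma solutionP a E0 x : ~~ a x -> alternates a (solution a E0).
Proof.
move=> ax; rewrite /solution; case: pickP => [E /andP[_ /forallP aE] y|no] /=.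
  exact/eqP/aE.
have [E aE] := alternates_exists ax; have /negP[] := no E; apply/andP; split.
  by apply/forallPn; exists x.
by apply/forallP=> y; rewrite aE.
Qed.

Lemma solution_all a E0 : (forall x, a x) -> solution a E0 = E0.
Proof.
move=> aT; rewrite /solution; case: pickP => //= E /andP[/forallPn[x]].
by rewrite aT.
Qed.

End Recursion.

(** * Singleton-free, adjacency-free and noncrossing partitions *)

Section Circle.
Variable n : nat.
Implicit Types (P Q : {set {set 'I_n}}) (E : {set 'I_n}) (x y : 'I_n).

Lemma SFP P : reflect (partition P setT /\ forall x, ~~ single P x) (P \in SF n).
Proof.
rewrite inE; apply: (iffP andP) => -[Pp]; have /and3P[_ Pt P0] := Pp.
  move/forall_inP=> s; split=> // x; apply/negP=> /singleP sx.
  have xP := in_cover x Pp.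
  have /negP[] := s _ (pblock_mem xP); apply/cards1P; exists x.
  apply/setP=> y; rewrite inE -sameE //; apply/idP/eqP => [/sx //|->].
  exact: same_refl.
move=> s; split=> //; apply/forall_inP=> B BP; apply/cards1P=> -[x Bx].
have /negP[] := s x; apply/singleP=> y.
by rewrite sameE // (def_pblock Pt BP) Bx inE // => /eqP.
Qed.

Lemma AFP P :
  reflect (partition P setT /\ forall x, ~~ same P x (ordS x)) (P \in AF n).
Proof.
rewrite inE; apply: (iffP andP) => -[Pp]; have /and3P[_ Pt P0] := Pp.
  move/forall_inP=> s; split=> // x.
  have xP := in_cover x Pp.
  have /forallP/(_ x) := s _ (pblock_mem xP).
  by rewrite mem_pblock xP sameE.
move=> s; split=> //; apply/forall_inP=> B BP; apply/forallP=> x.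
apply: contra (s x) => /andP[xB SxB].
by rewrite sameE // (def_pblock Pt BP xB).
Qed.

Lemma NCP P : partition P setT ->
  reflect (forall a b c d : 'I_n, a < b -> b < c -> c < d ->
            same P a c -> same P b d -> same P a b) (P \in NC n).
Proof.
move=> Pp; have /and3P[_ Pt P0] := Pp; rewrite inE Pp /=.
apply: (iffP idP) => [nc a b c d ab bc cd ac bd|nc].
  apply: contraNT nc => nab.
  have cov x := in_cover x Pp.
  apply/exists_inP; exists (pblock P a); first exact: pblock_mem.
  apply/exists_inP; exists (pblock P b); first exact: pblock_mem.
  apply/andP; split=> //.
  apply/existsP; exists a; apply/existsP; exists b.
  apply/existsP; exists c; apply/existsP; exists d.
  by rewrite ab bc cd !mem_pblock !cov -!sameE // ac.
apply/negP=> /exists_inP[B BP] /exists_inP[C CP] /andP[/eqP BC].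
case/existsP=> a /existsP[b] /existsP[c] /existsP[d].
case/and5P=> ab bc cd aB /and3P[cB bC dC]; apply: BC.
have := nc a b c d ab bc cd; rewrite /same.
rewrite (def_pblock Pt BP aB) (def_pblock Pt BP cB) (def_pblock Pt CP bC).
by rewrite (def_pblock Pt CP dC) => /(_ (eqxx _) (eqxx _)) /eqP.
Qed.

(** * Isolating and attaching marked elements *)

Definition pull E x := if x \in E then ord_pred x else x.

Definition attach Q E : {set {set 'I_n}} := ker (fun x => pblock Q (pull E x)).

Lemma same_attach Q E x y :
  same (attach Q E) x y = same Q (pull E x) (pull E y).
Proof. by rewrite same_ker. Qed.

(** The even positions in the runs of consecutive elements of the blocks of [P]. *)
Definition marks P E := forall x,
  (ordS x \in E) = same P x (ordS x) && (x \notin E).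

(** The marks seen from the image: the alternation starts at the end of each run
    of singletons of [Q] and goes backwards. *)
Definition comarks Q E := forall x,
  (x \in E) = single Q x && (ordS x \notin E).

Lemma ordS_neq x : 1 < n -> ordS x != x.
Proof.
move=> n1; apply/eqP=> /(congr1 val) /=; have xn := ltn_ord x.
have [e|ne] := eqVneq x.+1 n; first by rewrite e modnn; lia.
by rewrite modn_small; lia.
Qed.

(** The delicate point is that every unmarked singleton [x] of the image is followed
    by a mark.  As [P] has no singleton, [x] has a companion in its block; the
    companion must be marked, hence so placed that its unmarked predecessor lies
    in the same block.  That predecessor was not isolated, so it is [x]. *)
Lemma isolate_marks P E : P \in SF n -> marks P E ->
  [/\ isolate P E \in AF n, comarks (isolate P E) E & attach (isolate P E) E = P].
Proof.
case/SFP=> Pp s m; split.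
- apply/AFP; split=> [|x]; first exact: ker_partition.
  have [y yx _] := singleN (s x).
  have n1 : 1 < n.
    by have := ltn_ord y; have := ltn_ord x; rewrite -val_eqE /= in yx; lia.
  rewrite same_isolate eq_sym (negPf (ordS_neq x n1)) /= m negb_and negbK.
  by case: (x \in E); case: (same P _ _).
- move=> x; apply/idP/andP => [xE|[/singleP sx SxE]].
    split; last by rewrite m xE andbF.
    by apply/singleP=> y; rewrite same_isolate xE orbF => /eqP.
  apply: contraT => xE; have [y yx xy] := singleN (s x).
  have yE : y \in E.
    by apply: contraNT yx => yE; rewrite (sx y) // same_isolate xE yE xy orbT.
  move: (yE); rewrite -[y]ord_predK m => /andP[yy zE].
  have z : ord_pred y = x.
    apply: sx; rewrite same_isolate xE zE; apply/orP; right.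
    by apply: same_trans xy _; rewrite same_sym -{2}[y]ord_predK.
  by rewrite -z ord_predK yE in SxE.
apply: same_ext (ker_partition _) Pp _ => x y.
have pullE z : (pull E z \in E) = false /\ same P (pull E z) z.
  rewrite /pull; case: ifP => zE; last by rewrite zE same_refl.
  by move: zE; rewrite -[z in z \in E]ord_predK m ord_predK => /andP[-> /negPf].
have [xE xx] := pullE x; have [yE yy] := pullE y.
rewrite same_attach same_isolate xE yE /=.
rewrite /same in xx yy *; rewrite (eqP xx) (eqP yy).
by case: eqP => // e; rewrite -(eqP xx) -(eqP yy) e eqxx.
Qed.

(** No two neighbours are marked, so attaching is done in one step.  Every element
    acquires a companion: a marked one its predecessor, one followed by a mark
    its successor, and any other one was not a singleton of [Q]. *)
Lemma attach_comarks Q E : Q \in AF n -> comarks Q E ->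
  [/\ attach Q E \in SF n, marks (attach Q E) E & isolate (attach Q E) E = Q].
Proof.
case/AFP=> Qp s m.
have n1 x : ordS x != x.
  by apply: contraNN (s x) => /eqP ->; apply: same_refl.
have sparse x : x \in E -> ordS x \in E = false.
  by rewrite m => /andP[_ /negPf].
have sparseP x : x \in E -> ord_pred x \in E = false.
  by move=> xE; apply: contraTF xE => /sparse; rewrite ord_predK => ->.
have sing x y : x \in E -> same Q x y -> y = x.
  by rewrite m => /andP[/singleP sx _]; apply: sx.
split.
- apply/SFP; split=> [|x]; first exact: ker_partition.
  apply/negP=> /singleP sx.
  have [xE|xE] := boolP (x \in E).
    have /eqP[] := n1 (ord_pred x); rewrite ord_predK; apply/esym/sx.
    by rewrite same_attach /pull xE sparseP // same_refl.
  have [SxE|SxE] := boolP (ordS x \in E).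
    have /eqP[] := n1 x; apply: sx.
    by rewrite same_attach /pull (negPf xE) SxE ordSK same_refl.
  have /singleN[y /eqP yx xy] : ~~ single Q x.
    by move: xE; rewrite m SxE andbT.
  case: yx; apply: sx; rewrite same_attach /pull (negPf xE).
  case: ifP => // yE; case/negP: xE.
  by rewrite (sing y x yE) // same_sym.
- move=> x; apply/idP/andP => [SxE|[xS xE]].
    have xE : x \notin E by rewrite -[x]ordSK sparseP.
    by rewrite same_attach /pull SxE (negPf xE) ordSK same_refl.
  apply: contraLR xS => SxE; rewrite same_attach /pull.
  by rewrite (negPf xE) (negPf SxE).
apply: same_ext (ker_partition _) Qp _ => x y.
rewrite same_isolate same_attach /pull.
have [->|xy] := eqVneq x y; first by rewrite !same_refl.
case: ifP => xE /=.
  by apply/esym/(contraNF _ xy) => /(sing _ _ xE) ->; rewrite eqxx.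
case: ifP => yE //=.
by apply/esym/(contraNF _ xy); rewrite same_sym => /(sing _ _ yE) ->; rewrite eqxx.
Qed.

Lemma isolate_NC P E : partition P setT -> P \in NC n -> isolate P E \in NC n.
Proof.
move=> Pp /(NCP Pp) nc; apply/NCP; first exact: ker_partition.
move=> a b c d ab bc cd; rewrite !same_isolate -!val_eqE /=.
have -> : (a == c :> nat) = false by lia.
have -> : (b == d :> nat) = false by lia.
case/and3P=> -> _ ac /and3P[-> _ bd].
by rewrite (nc a b c d) // orbT.
Qed.

Lemma val_pull E x :
  val (pull E x) = x \/ val (pull E x) = x.-1 /\ 0 < x \/
  x = 0 :> nat /\ val (pull E x) = n.-1.
Proof.
rewrite /pull; case: ifP => _ /=; last by left.
right; have xn := ltn_ord x.
case: (posnP x) => [->|x0]; first by right; rewrite modn_small; lia.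
left; split=> //; have -> : (x + n).-1 = x.-1 + n by lia.
by rewrite modnDr modn_small; lia.
Qed.

(** [pull] moves an element at most one step back, which keeps the four points in
    cyclic order.  If two of them collide the conclusion is immediate; the other
    case in which the linear order changes is [a] wrapping around from the first
    position to the last, beyond [d], and then the noncrossing condition applies
    to the four points rotated by one place. *)
Lemma attach_NC Q E : partition Q setT -> Q \in NC n -> attach Q E \in NC n.
Proof.
move=> Qp /(NCP Qp) nc; apply/NCP; first exact: ker_partition.
move=> a b c d ab bc cd; rewrite !same_attach.
have := val_pull E a; have := val_pull E b.
have := val_pull E c; have := val_pull E d.
have := ltn_ord d; move: (pull E a) (pull E b) (pull E c) (pull E d).
move=> a' b' c' d' dn hd hc hb ha ac bd.
have ab' : a' = b' -> same Q a' b' by move=> ->; apply: same_refl.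
have acb : c' = b' -> same Q a' b' by move=> <-.
have adb : d' = a' -> same Q a' b' by move=> <-; rewrite same_sym.
have cdb : d' = c' -> same Q a' b'.
  by move=> e; rewrite e same_sym in bd; apply: same_trans ac bd.
have [/val_inj //|ne1] := eqVneq (val a') (val b').
have [/val_inj //|ne2] := eqVneq (val c') (val b').
have [/val_inj //|ne3] := eqVneq (val d') (val a').
have [/val_inj //|ne4] := eqVneq (val d') (val c').
move: ne1 ne2 ne3 ne4 ha hb hc hd => /= ne1 ne2 ne3 ne4 ha hb hc hd.
have bc' : b' < c' by lia.
have cd' : c' < d' by lia.
case: (ltnP a' b') => a'b'; first exact: (nc a' b' c' d').
have da' : d' < a' by lia.
rewrite same_sym in ac; rewrite same_sym; apply: same_trans (ac).
exact: (nc b' c' d' a').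
Qed.

(** * The marks of a partition *)

Lemma val_iter_ordS k x : iter k (@ordS n) x = (x + k) %% n :> nat.
Proof.
elim: k => [|k IHk]; first by rewrite addn0 modn_small.
by rewrite iterS /= IHk -addn1 modnDml -addnA addn1.
Qed.

Lemma ordS_cyclic x y : exists k, iter k (@ordS n) x = y.
Proof.
exists (y + (n - x)); apply/ord_inj; rewrite val_iter_ordS.
have xn := ltn_ord x; have -> : x + (y + (n - x)) = y + n by lia.
by rewrite modnDr modn_small.
Qed.

Lemma ord_pred_cyclic x y : exists k, iter k (@ord_pred n) x = y.
Proof.
have [k <-] := ordS_cyclic y x; exists k.
by elim: k => //= k IHk; rewrite -iterS iterSr ordSK.
Qed.

Definition odds : {set 'I_n} := [set x : 'I_n | odd x].

Definition alternating E := forall x, (ordS x \in E) = (x \notin E).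

(** Going once around the circle flips membership [n] times, which forces [n] to be
    even; the value at the first position then decides between the two sets. *)
Lemma alternatingP E : 0 < n -> alternating E ->
  ~~ odd n /\ (E = odds \/ E = ~: odds).
Proof.
move=> n0 alt.
have alt_iter k x : (iter k (@ordS n) x \in E) = odd k (+) (x \in E).
  by elim: k => //= k IHk; rewrite alt IHk; case: odd; case: (x \in E).
pose x := Ordinal n0; split.
  have := alt_iter n x.
  have -> : iter n (@ordS n) x = x.
    by apply/ord_inj; rewrite val_iter_ordS modnDr modn_small.
  by case: odd; case: (x \in E).
have xE y : (y \in E) = odd y (+) (x \in E).
  rewrite -alt_iter; congr (_ \in E); apply/ord_inj.
  by rewrite val_iter_ordS add0n modn_small.
case xin: (x \in E) xE => xE; [right|left]; apply/setP=> y; rewrite xE !inE //.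
  by rewrite addbT.
by rewrite addbF.
Qed.

Lemma odds_alternating : ~~ odd n -> alternating odds.
Proof.
move=> nev x; rewrite !inE /=; have xn := ltn_ord x.
have [e|ne] := eqVneq x.+1 n; last by rewrite modn_small //; lia.
rewrite e modnn; have := congr1 odd e; rewrite (negPf nev) /=.
by move/negbFE->.
Qed.

Lemma evens_alternating : ~~ odd n -> alternating (~: odds).
Proof. by move=> nev x; rewrite !in_setC odds_alternating. Qed.

Definition adjacent P x := same P x (ordS x).

(** The backward recursion of [comarks] runs along [ord_pred], so its condition is
    read one place earlier. *)
Definition pred_single Q x := single Q (ord_pred x).

Definition marked P := solution (@ordS n) (adjacent P) odds.
Definition comarked Q :=
  solution (@ord_pred n) (pred_single Q) odds.

Lemma comarks_alternates Q E :
  comarks Q E <-> alternates (@ord_pred n) (pred_single Q) E.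
Proof.
split=> [m x|m x]; first by rewrite m /pred_single ord_predK.
by have := m (ordS x); rewrite /pred_single ordSK.
Qed.

Lemma topP P : partition P setT -> P <> top -> exists x, ~~ adjacent P x.
Proof.
move=> Pp PT; apply/forallPn; apply: contra_notN PT => /forallP adj.
apply: same_ext Pp (ker_partition _) _ => x y; rewrite same_top.
have [k <-] := ordS_cyclic x y; elim: k => [|k IHk]; first exact: same_refl.
exact: same_trans IHk (adj _).
Qed.

Lemma botNP Q : partition Q setT -> Q <> bot -> exists x, ~~ pred_single Q x.
Proof.
move=> Qp QB; apply/forallPn; apply: contra_notN QB => /forallP s.
by apply: botP => // x; have := s (ordS x); rewrite /pred_single ordSK.
Qed.

Lemma single_bot x : single bot x.
Proof. by apply/singleP=> y; rewrite same_bot eq_sym => /eqP. Qed.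

Lemma marks_top E : marks top E <-> alternating E.
Proof. by split=> m x; rewrite m same_top. Qed.

Lemma comarks_bot E : comarks bot E <-> alternating E.
Proof.
by split=> m x; [rewrite [x \in E]m single_bot | rewrite single_bot m]; rewrite negbK.
Qed.

Hypothesis n0 : 0 < n.

Lemma marks_marked P : partition P setT -> P <> top -> marks P (marked P).
Proof.
move=> Pp PT; have [x ax] := topP Pp PT.
exact: (solutionP (@ordSK n) ordS_cyclic _ ax).
Qed.

Lemma marked_top : marked top = odds.
Proof. by apply: solution_all => x; apply: same_top. Qed.

Lemma marks_unique P E : partition P setT -> marks P E ->
  E = marked P \/ [/\ ~~ odd n, P = top & E = ~: odds].
Proof.
move=> Pp m; have [PT|/eqP PT] := eqVneq P top.
  rewrite PT marked_top; rewrite PT in m.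
  have [nev [->|->]] := alternatingP n0 (iffLR (marks_top E) m); first by left.
  by right.
left; have [x ax] := topP Pp PT.
exact: (alternates_unique ordS_cyclic ax m (marks_marked Pp PT)).
Qed.

Lemma comarks_comarked Q : partition Q setT -> Q <> bot -> comarks Q (comarked Q).
Proof.
move=> Qp QB; have [x ax] := botNP Qp QB; apply/comarks_alternates.
exact: (solutionP (@ord_predK n) ord_pred_cyclic _ ax).
Qed.

Lemma comarked_bot : comarked bot = odds.
Proof. by apply: solution_all => x; apply: single_bot. Qed.

Lemma comarks_unique Q E : partition Q setT -> comarks Q E ->
  E = comarked Q \/ [/\ ~~ odd n, Q = bot & E = ~: odds].
Proof.
move=> Qp m; have [QB|/eqP QB] := eqVneq Q bot.
  rewrite QB comarked_bot; rewrite QB in m.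
  have [nev [->|->]] := alternatingP n0 (iffLR (comarks_bot E) m); first by left.
  by right.
left; have [x ax] := botNP Qp QB.
apply: (alternates_unique ord_pred_cyclic ax); apply/comarks_alternates => //.
exact: comarks_comarked.
Qed.

Lemma SF_gt1 P : P \in SF n -> 1 < n.
Proof.
case/SFP=> _ /(_ (Ordinal n0)) /singleN[y]; rewrite -val_eqE /= => y0 _.
by have := ltn_ord y; lia.
Qed.

Lemma AF_gt1 P : P \in AF n -> 1 < n.
Proof.
case/AFP=> _ /(_ (Ordinal n0)) adj; rewrite ltnNge; apply: contra adj => n1.
have -> : ordS (Ordinal n0) = Ordinal n0; last exact: same_refl.
by apply/val_inj => /=; move: n0 n1; case: (n) => [|[|]].
Qed.

Lemma top_SF : 1 < n -> top \in SF n.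
Proof.
move=> n1; apply/SFP; split=> [|x]; first exact: ker_partition.
apply/negP=> /singleP/(_ (ordS x) (same_top _ _)) /eqP.
by rewrite (negPf (ordS_neq x n1)).
Qed.

Lemma bot_AF : 1 < n -> bot \in AF n.
Proof.
move=> n1; apply/AFP; split=> [|x]; first exact: ker_partition.
by rewrite same_bot eq_sym ordS_neq.
Qed.

Lemma top_NC : top \in NC n.
Proof. by apply/NCP => [|*]; [apply: ker_partition | apply: same_top]. Qed.

Lemma bot_NC : bot \in NC n.
Proof.
apply/NCP => [|a b c d ab bc cd]; first exact: ker_partition.
by rewrite !same_bot => /eqP ac; move: ab bc; rewrite ac; lia.
Qed.

(** * The bijection *)

Lemma ordS_of_neq x y : n <= 2 -> y != x -> y = ordS x.
Proof.
move=> n2 yx; apply/ord_inj => /=; rewrite -val_eqE /= in yx.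
have xn := ltn_ord x; have yn := ltn_ord y.
have [e|ne] := eqVneq x.+1 n; first by rewrite e modnn; lia.
by rewrite modn_small; lia.
Qed.

Lemma SF_le2 P : n <= 2 -> P \in SF n -> P = top.
Proof.
move=> n2 /SFP[Pp s]; have [//|/eqP /(topP Pp)[x]] := eqVneq P top.
have [y yx xy] := singleN (s x).
by rewrite /adjacent -(ordS_of_neq n2 yx) xy.
Qed.

Lemma AF_le2 Q : n <= 2 -> Q \in AF n -> Q = bot.
Proof.
move=> n2 /AFP[Qp s]; apply: botP => // x; apply/singleP=> y.
by apply: contraTeq => /(ordS_of_neq n2) ->.
Qed.

(** For odd [n] the partitions [top] and [bot] carry no marks and are matched with
    each other.  For even [n > 2] the leftovers are what the second mark set, the
    even positions, gives for [bot] and for [top].  For [n = 2] these would again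
    be [top] and [bot]. *)
Definition exceptional := ~~ odd n && (2 < n).

Definition excS := if exceptional then attach bot (~: odds) else top.
Definition excA := if exceptional then isolate top (~: odds) else bot.

Definition Phi P := if P == excS then excA else isolate P (marked P).
Definition Theta Q := if Q == excA then excS else attach Q (comarked Q).

Lemma odds_neqC : odds <> ~: odds.
Proof. by move/setP/(_ (Ordinal n0)); rewrite !inE. Qed.

Lemma excA_spec : exceptional ->
  [/\ excA \in AF n, comarks excA (~: odds) & attach excA (~: odds) = top].
Proof.
rewrite /excA => exc; rewrite exc; case/andP: exc => nev n2.
apply: isolate_marks; first exact/top_SF/ltnW.
exact/marks_top/evens_alternating.
Qed.

Lemma excS_spec : exceptional ->
  [/\ excS \in SF n, marks excS (~: odds) & isolate excS (~: odds) = bot].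
Proof.
rewrite /excS => exc; rewrite exc; case/andP: exc => nev n2.
apply: attach_comarks; first exact/bot_AF/ltnW.
exact/comarks_bot/evens_alternating.
Qed.

(** Positions 1 and 3 are unmarked and distinct: they stay together when the even
    positions are isolated from [top], and remain apart when the even positions
    are attached in [bot]. *)
Lemma exceptional_refines : exceptional ->
  exists x y, same excA x y /\ ~~ same excS x y.
Proof.
rewrite /excA /excS => exc; rewrite exc; case/andP: exc => nev n2.
have n4 : 3 < n by rewrite ltn_neqAle n2 andbT; apply: contraNneq nev => <-.
have n1 := ltnW n2.
exists (Ordinal n1), (Ordinal n4); rewrite same_isolate same_attach /pull !inE /=.
by rewrite same_top same_bot.
Qed.

Lemma excS_neq_top : exceptional -> excS <> top.
Proof.
by case/exceptional_refines => x [y [_ /negP nxy]] e; apply: nxy; rewrite e same_top.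
Qed.

Lemma excA_neq_bot : exceptional -> excA <> bot.
Proof.
case/exceptional_refines => x [y [xy /negP nxy]] e; apply: nxy.
by move: xy; rewrite e same_bot => /eqP ->; apply: same_refl.
Qed.

Lemma marked_SF P : P \in SF n -> P <> excS -> marks P (marked P).
Proof.
move=> /SFP[Pp s] PS; have [PT|/eqP PT] := eqVneq P top; last exact: marks_marked.
move: PS; rewrite PT marked_top /excS; case: ifP => // /andP[nev _] _.
exact/marks_top/odds_alternating.
Qed.

Lemma comarked_AF Q : Q \in AF n -> Q <> excA -> comarks Q (comarked Q).
Proof.
move=> /AFP[Qp s] QA; have [QB|/eqP QB] := eqVneq Q bot; last exact: comarks_comarked.
move: QA; rewrite QB comarked_bot /excA; case: ifP => // /andP[nev _] _.
exact/comarks_bot/odds_alternating.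
Qed.

Lemma excSA : excS \in SF n -> excA \in AF n.
Proof.
move=> /SF_gt1 n1; have [/excA_spec[] //|exc] := boolP exceptional.
by rewrite /excA (negPf exc) bot_AF.
Qed.

Lemma excAS : excA \in AF n -> excS \in SF n.
Proof.
move=> /AF_gt1 n1; have [/excS_spec[] //|exc] := boolP exceptional.
by rewrite /excS (negPf exc) top_SF.
Qed.

Lemma excSE : ~~ exceptional -> excS = top.
Proof. by rewrite /excS => /negPf->. Qed.

Lemma excAE : ~~ exceptional -> excA = bot.
Proof. by rewrite /excA => /negPf->. Qed.

(** Two things could go wrong.  If the image were [excA], its marks would be the even
    positions, whence [P = top], which was given the odd ones; outside the
    exceptional case [excA] is [bot], whose marks alternate, so [n] is even, hence
    equal to 2, and [P = top = excS].  If the marks were not those that [Theta]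
    chooses, they would be the even positions over [bot],
    whence [P = excS]. *)
Lemma PhiK P : P \in SF n -> Phi P \in AF n /\ Theta (Phi P) = P.
Proof.
move=> PSF; rewrite /Phi; case: eqP => [PS|PS].
  by rewrite excSA -?PS // /Theta eqxx.
have m := marked_SF PSF PS; have [QA cm attQ] := isolate_marks PSF m.
have [Pp _] := SFP _ PSF; have [Qp _] := AFP _ QA.
split=> //; rewrite /Theta; case: eqP => [eA|neA].
  have [exc|exc] := boolP exceptional.
    have [_ cm1 att1] := excA_spec exc; rewrite eA in cm attQ.
    have uniq E : comarks excA E -> E = comarked excA.
      rewrite eA in Qp; case/(comarks_unique Qp) => // -[_ e _].
      by case: (excA_neq_bot exc).
    have e : marked P = ~: odds by rewrite (uniq _ cm) (uniq _ cm1).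
    by case: odds_neqC; rewrite -e -attQ e att1 marked_top.
  rewrite eA excAE // in cm; have [nev _] := alternatingP n0 (iffLR (comarks_bot _) cm).
  by rewrite excSE // (SF_le2 _ PSF) // leqNgt; apply: contra exc => n2; apply/andP.
case: (comarks_unique Qp cm) => [<- //|[nev eB e]].
case: PS; rewrite -attQ eB e /excS /exceptional nev ltnNge.
case: leqP => // n2; rewrite -(SF_le2 n2 PSF) -[RHS]attQ eB e //.
Qed.

(** The argument for [PhiK] with the roles of [top] and [bot] exchanged. *)
Lemma ThetaK Q : Q \in AF n -> Theta Q \in SF n /\ Phi (Theta Q) = Q.
Proof.
move=> QAF; rewrite /Theta; case: eqP => [QA|QA].
  by rewrite excAS -?QA // /Phi eqxx.
have m := comarked_AF QAF QA; have [PS cm isoP] := attach_comarks QAF m.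
have [Qp _] := AFP _ QAF; have [Pp _] := SFP _ PS.
split=> //; rewrite /Phi; case: eqP => [eS|neS].
  have [exc|exc] := boolP exceptional.
    have [_ cm1 iso1] := excS_spec exc; rewrite eS in cm isoP.
    have uniq E : marks excS E -> E = marked excS.
      rewrite eS in Pp; case/(marks_unique Pp) => // -[_ e _].
      by case: (excS_neq_top exc).
    have e : comarked Q = ~: odds by rewrite (uniq _ cm) (uniq _ cm1).
    by case: odds_neqC; rewrite -e -isoP e iso1 comarked_bot.
  rewrite eS excSE // in cm; have [nev _] := alternatingP n0 (iffLR (marks_top _) cm).
  by rewrite excAE // (AF_le2 _ QAF) // leqNgt; apply: contra exc => n2; apply/andP.
case: (marks_unique Pp cm) => [<- //|[nev eT e]].
case: QA; rewrite -isoP eT e /excA /exceptional nev ltnNge.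
case: leqP => // n2; rewrite -(AF_le2 n2 QAF) -[RHS]isoP eT e //.
Qed.

Lemma excS_NC : excS \in NC n.
Proof.
rewrite /excS; case: ifP => _; last exact: top_NC.
by apply: attach_NC; [apply: ker_partition | apply: bot_NC].
Qed.

Lemma excA_NC : excA \in NC n.
Proof.
rewrite /excA; case: ifP => _; last exact: bot_NC.
by apply: isolate_NC; [apply: ker_partition | apply: top_NC].
Qed.

Lemma Phi_NC P : P \in SF n -> P \in NC n -> Phi P \in NC n.
Proof.
move=> /SFP[Pp _] Pnc; rewrite /Phi; case: eqP => _; first exact: excA_NC.
exact: isolate_NC.
Qed.

Lemma Theta_NC Q : Q \in AF n -> Q \in NC n -> Theta Q \in NC n.
Proof.
move=> /AFP[Qp _] Qnc; rewrite /Theta; case: eqP => _; first exact: excS_NC.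
exact: attach_NC.
Qed.

Lemma isolate_refines P E : partition P setT -> refines (isolate P E) P.
Proof.
move=> Pp; apply/refinesP => //; first exact: ker_partition.
by move=> x y; rewrite same_isolate => /orP[/eqP->|/and3P[]//]; apply: same_refl.
Qed.

Lemma excA_not_refines : exceptional -> ~~ refines excA excS.
Proof.
move=> exc; have [/AFP[Ap _] _ _] := excA_spec exc.
have [/SFP[Sp _] _ _] := excS_spec exc.
apply/negP=> /(refinesP Ap Sp) r; have [x [y [xy /negP[]]]] := exceptional_refines exc.
exact: r.
Qed.

(** Two elements that [pull] sends to the same place are equal or cyclically
    adjacent, and an adjacency-free partition cannot join them in the second
    case. *)
Lemma AF_below_attach_bot Q E : Q \in AF n -> refines Q (attach bot E) -> Q = bot.
Proof.
move=> /AFP[Qp s] /(refinesP Qp (ker_partition _)) r.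
apply: botP => // x; apply/singleP=> y xy; have := r _ _ xy.
rewrite same_attach same_bot /pull; case: ifP => _; case: ifP => _ /eqP //.
- by move/(can_inj (@ord_predK n)).
- by move=> e; move: (s y); rewrite -{2}e ord_predK same_sym xy.
- by move=> e; move: (s x); rewrite {2}e ord_predK xy.
Qed.

(** Refinement at both pairings of neighbours would send both of them to [bot]. *)
Lemma exception_forced (Psi : {set {set 'I_n}} -> {set {set 'I_n}}) :
  exceptional -> bij_between Psi (SF n) (AF n) ->
  exists P, P \in SF n /\ ~ refines (Psi P) P.
Proof.
move=> exc [Psi_inj Psi_im]; have /andP[nev n2] := exc.
have n1 := ltnW n2.
have [SF_odds _ _] :=
  attach_comarks (bot_AF n1) (iffRL (comarks_bot _) (odds_alternating nev)).
have [SF_evens _ _] :=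
  attach_comarks (bot_AF n1) (iffRL (comarks_bot _) (evens_alternating nev)).
have PsiAF P : P \in SF n -> Psi P \in AF n by move=> PS; rewrite -Psi_im imset_f.
set P1 := attach bot odds in SF_odds *.
set P2 := attach bot (~: odds) in SF_evens *.
have [r1|/negP r1] := boolP (refines (Psi P1) P1); last by exists P1.
have [r2|/negP r2] := boolP (refines (Psi P2) P2); last by exists P2.
have e : P1 = P2.
  apply: Psi_inj => //.
  by rewrite (AF_below_attach_bot (PsiAF _ SF_odds) r1)
             (AF_below_attach_bot (PsiAF _ SF_evens) r2).
pose x := Ordinal n0; pose y := Ordinal n1.
(* Attaching the odd positions pairs 0 with 1; attaching the even ones pairs 0
   with [n - 1]. *)
have : same P1 x y.
  by rewrite same_attach same_bot /pull !inE /= -val_eqE /= modnn.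
rewrite e same_attach same_bot /pull !inE /= -val_eqE /=.
by rewrite modn_small; lia.
Qed.

End Circle.

Theorem theorem1 (n : nat) (hn : 1 <= n) :
  (exists Phi : {set {set 'I_n}} -> {set {set 'I_n}},
      [/\ bij_between Phi (SF n) (AF n),
          (~ (~~ odd n /\ 2 < n) ->
             forall P, P \in SF n -> refines (Phi P) P),
          (~~ odd n /\ 2 < n ->
             exists! P, P \in SF n /\ ~ refines (Phi P) P)
        & bij_between Phi (SF n :&: NC n) (AF n :&: NC n)])
  /\
  (~~ odd n /\ 2 < n ->
     forall Psi : {set {set 'I_n}} -> {set {set 'I_n}},
       bij_between Psi (SF n) (AF n) ->
       exists P, P \in SF n /\ ~ refines (Psi P) P).
Proof.
split; last by move=> /andP exc Psi; apply: exception_forced.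
have Phi_inj : {in SF n &, injective (@Phi n)}.
  by move=> P P' /(PhiK hn)[_ {2}<-] /(PhiK hn)[_ {2}<-] ->.
exists (@Phi n); split.
- split=> //; apply/setP=> Q; apply/imsetP/idP => [[P PS ->]|QA].
    by case: (PhiK hn PS).
  by have [TS TK] := ThetaK hn QA; exists (Theta Q).
- move=> nexc P PS; have /SFP[Pp _] := PS.
  have exc : ~~ exceptional n by apply/negP => /andP.
  rewrite /Phi excSE // excAE //; case: eqP => [->|_]; last exact: isolate_refines.
  apply/refinesP; try exact: ker_partition.
  by move=> x y _; apply: same_top.
- move=> /andP exc; exists (excS n); split.
    have [SS _ _] := excS_spec exc; split=> //.
    by rewrite /Phi eqxx; apply/negP/excA_not_refines.
  move=> P [PS]; rewrite /Phi; case: eqP => [->//|_] [].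
  by apply: isolate_refines; case/SFP: PS.
- split=> [P P'|]; first by move=> /setIP[PS _] /setIP[PS' _]; apply: Phi_inj.
  apply/setP=> Q; apply/imsetP/setIP => [[P /setIP[PS PN] ->]|[QA QN]].
    by split; [case: (PhiK hn PS) | apply: Phi_NC].
  have [TS TK] := ThetaK hn QA; exists (Theta Q) => //.
  by apply/setIP; split=> //; apply: Theta_NC.
Qed.
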